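(* Let $n,f$ be positive integers and let $a,b$ be even integers with $0<a<b<n/2$. There exists a self-complementary binary $(n,2fn)$ code $C$ such that \[ \{i\in\{0,1,\ldots,n\}:A_i(C)\ne0\}=\{0,\ n/2\pm a,\ n/2\pm b,\ n/2,\ n\},\qquad A_{n/2}(C)=2n-2, \] and $C=C_1\cup C_2\cup\cdots\cup C_f$ where each $C_i$ has distance distribution with $A_0(C_i)=1$, $A_{n/2}(C_i)=2n-2$, $A_n(C_i)=1$ and all other $A_j(C_i)=0$, if and only if there exists a set of $f$ mutually Type~II weakly unbiased Hadamard matrices of order $n$ such that $\sigma(H,K)=\{2a,2b\}$ for any two distinct members $H,K$ of the set.
   Context: A binary $(n,M)$ code is a subset of $\mathbb{Z}_2^n$ of size $M$; $A_i(C)=\frac{1}{|C|}|\{(x,x')\in C\times C: d(x,x')=i\}|$ with $d$ Hamming distance; $C$ is self-complementary if $x+\mathbf{1}\in C$ for all $x\in C$. A Hadamard matrix of order $n$ is an $n\times n$ $(\pm1)$-matrix $H$ with $HH^T=nI_n$. For Hadamard matrices $H,K$ with $a_{ij}$ the $(i,j)$-entry of $HK^T$, $\sigma(H,K)=\{|a_{ij}|\}$. $H,K$ are Type~II weakly unbiased if $a_{ij}\equiv 0\pmod 4$ for all $i,j$ and $|\sigma(H,K)|\le2$, unbiased pairs (all $|a_{ij}|=\sqrt n$) being excluded. A set is mutually Type~II weakly unbiased if every pair of distinct members is.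
   Formalization: The formal theorem assumes f ≥ 2 instead of f ≥ 1: for f = 1 the claim fails (n = 12, a = 2, b = 4), since one Hadamard matrix satisfies the matrix side vacuously while C = C_1 cannot have the distances n/2 ± a, n/2 ± b. *)

(* Defs.v *)
From HB Require Import structures.
From mathcomp Require Import all_boot all_order all_algebra all_field.
Set Implicit Arguments.
Unset Strict Implicit.
Unset Printing Implicit Defensive.
Import Order.TTheory GRing.Theory Num.Theory.
Local Open Scope ring_scope.

Definition hamming (n : nat) (x y : 'rV['F_2]_n) : nat :=
  #|[set i : 'I_n | x 0 i != y 0 i]|.

(* The index is rational so that A_{n/2}(C) makes sense without assuming that
   n is even; A_i(C) = 0 when i is not an integer in [0, n]. *)
Definition dist_distr (n : nat) (C : {set 'rV['F_2]_n}) (i : rat) : rat :=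
  #|[set p in setX C C | (hamming p.1 p.2)%:R == i]|%:R / #|C|%:R.

Definition distances (n : nat) (C : {set 'rV['F_2]_n}) : seq rat :=
  [seq i%:R | i <- iota 0 n.+1 & dist_distr C i%:R != 0].

Definition self_complementary (n : nat) (C : {set 'rV['F_2]_n}) : Prop :=
  forall x, x \in C -> x + const_mx 1 \in C.

Definition hadamard (n : nat) (H : 'M[int]_n) : Prop :=
  (forall i j, H i j = 1 \/ H i j = -1) /\ H *m H^T = n%:R%:M.

(* A duplicate-free enumeration, so that [size (sigma H K)] is the cardinality
   of the set and [=i] is equality of sets. *)
Definition sigma (n : nat) (H K : 'M[int]_n) : seq nat :=
  undup [seq `|(H *m K^T) i j|%N | i <- enum 'I_n, j <- enum 'I_n].

Definition unbiased (n : nat) (H K : 'M[int]_n) : Prop :=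
  forall i j, `|(H *m K^T) i j|%N%:R = sqrtC n%:R :> algC.

Definition typeII_weakly_unbiased (n : nat) (H K : 'M[int]_n) : Prop :=
  [/\ forall i j, ((H *m K^T) i j = 0 %[mod 4])%Z,
      (size (sigma H K) <= 2)%N
    & ~ unbiased H K].

Definition mutually_typeII_weakly_unbiased (n : nat) (S : seq 'M[int]_n)
    : Prop :=
  {in S &, forall H K, H != K -> typeII_weakly_unbiased H K}.

(* Main.v *)
(* Writing a binary word x as the sign vector (-1)^x turns Hamming distance d
   into the inner product n - 2d. A self-complementary code of size 2n with
   distances 0, n/2, n is thus the set of words of the rows of H and -H for a
   Hadamard matrix H, and the distances between two such codes are read off
   H K^T up to sign. Counting the pairs at distance n/2 shows that in C no such
   pair joins two distinct blocks, so that all entries of H K^T are +-2a or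
   +-2b. That both values occur for every pair H, K follows from Parseval: the
   squares in each row of H K^T sum to n^2, so 2a occurs iff n < (2b)^2 and 2b
   occurs iff (2a)^2 < n, conditions which do not involve H and K. *)
Require Import Defs.
From mathcomp Require Import all_boot all_order all_algebra all_field.
From mathcomp Require Import zify lra.
Import Order.TTheory GRing.Theory Num.Theory.
Set Implicit Arguments.
Unset Strict Implicit.
Unset Printing Implicit Defensive.
Local Open Scope ring_scope.

(** * Binary words, complements and distance distributions *)

Section Words.
Variable n : nat.
Implicit Types (x y : 'rV['F_2]_n) (C : {set 'rV['F_2]_n}).

Definition sgn (u : 'F_2) : int := if u == 0 then 1 else -1.

Definition compl x := x + const_mx 1.

Lemma F2_case (u : 'F_2) : u = 0 \/ u = 1.
Proof. by case: u => [[|[|//]] hu]; [left|right]; apply: val_inj. Qed.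

Lemma sgnD1 (u : 'F_2) : sgn (u + 1) = - sgn u.
Proof. by case: (F2_case u) => ->. Qed.

Lemma complK : involutive compl.
Proof.
move=> x; apply/rowP=> i; rewrite !mxE.
by case: (F2_case (x 0 i)) => ->; apply: val_inj.
Qed.

Lemma sgn_sum x y :
  \sum_i sgn (x 0 i) * sgn (y 0 i) = n%:Z - (2 * hamming x y)%:Z.
Proof.
have -> : n%:Z = \sum_(i < n) 1 :> int.
  by rewrite sumr_const cardT size_enum_ord natz.
have -> : hamming x y = (\sum_(i < n) (x 0%R i != y 0%R i))%N.
  rewrite /hamming cardsE -sum1_card big_mkcond.
  by apply: eq_bigr => i _; rewrite unfold_in; case: (_ != _).
rewrite big_distrr /= -natz natr_sum -sumrB; apply: eq_bigr => i _.
by case: (F2_case (x 0 i)) => ->; case: (F2_case (y 0 i)) => ->.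
Qed.

Lemma hamming_leq x y : (hamming x y <= n)%N.
Proof. by rewrite -[leqRHS]card_ord max_card. Qed.

Lemma hamming_eq0 x y : (hamming x y == 0%N) = (x == y).
Proof.
rewrite cards_eq0; apply/eqP/eqP => [h|->]; last first.
  by apply/setP=> i; rewrite !inE eqxx.
by apply/rowP=> i; apply/eqP/negPn; move/setP/(_ i): h; rewrite !inE => ->.
Qed.

Lemma hamming_compl x y : hamming x (compl y) = (n - hamming x y)%N.
Proof.
have := sgn_sum x (compl y).
under eq_bigr do rewrite !mxE sgnD1 mulrN.
rewrite sumrN sgn_sum; have := hamming_leq x y.
have := hamming_leq x (compl y); lia.
Qed.

Lemma hamming_eqn x y : (hamming x y == n) = (y == compl x).
Proof.
rewrite -(inj_eq (can_inj (@complK))) complK [RHS]eq_sym -hamming_eq0.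
rewrite hamming_compl.
by rewrite subn_eq0 eqn_leq hamming_leq.
Qed.

Definition neigh C d x := [set y in C | hamming x y == d].

(** Grouping the ordered pairs by their first component makes [A_d(C)] the average, over the words
    of [C], of the number of words at distance [d]. *)
Lemma dist_distrE C (d : nat) :
  dist_distr C d%:R = (\sum_(x in C) #|neigh C d x|)%:R / #|C|%:R.
Proof.
congr (_%:R / _); under eq_bigr do rewrite -sum1dep_card.
rewrite pair_big_dep -sum1dep_card; apply: eq_bigl => -[x y] /=.
by rewrite !inE eqr_nat -andbA.
Qed.

Lemma dist_distr_const C (d c : nat) : C != set0 ->
  (forall x, x \in C -> #|neigh C d x| = c) -> dist_distr C d%:R = c%:R.
Proof.
rewrite -card_gt0 => C0 h; rewrite dist_distrE (eq_bigr _ h) sum_nat_const.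
by rewrite natrM mulrC mulKf // pnatr_eq0 -lt0n.
Qed.

Lemma dist_distr_sum C (d : nat) (c : rat) : C != set0 ->
  dist_distr C d%:R = c -> (\sum_(x in C) #|neigh C d x|)%:R = #|C|%:R * c.
Proof.
rewrite -card_gt0 dist_distrE => C0 <-; rewrite mulrCA divff ?mulr1 //.
by rewrite pnatr_eq0 -lt0n.
Qed.

Lemma dist_distr_eq0P C (d : nat) :
  reflect (forall x y, x \in C -> y \in C -> hamming x y != d)
          (dist_distr C d%:R == 0).
Proof.
rewrite dist_distrE mulf_eq0 invr_eq0 !pnatr_eq0 orbC cards_eq0.
(* For the empty code the quotient is [0 / 0 = 0] and the condition on pairs is vacuous. *)
case: eqP => [->|C0] /=; first by constructor=> x y; rewrite inE.
rewrite sum_nat_eq0.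
apply: (iffP forall_inP) => [h x y xC yC|h x xC].
  apply/negP=> hd; have := h x xC; rewrite cards_eq0 => /eqP/setP/(_ y).
  by rewrite !inE yC hd.
by rewrite cards_eq0; apply/eqP/setP=> y; rewrite !inE; apply/andP=> -[/(h x y xC)/negP].
Qed.

(** Any pair counted at index [q] shows that [q] is a Hamming distance; at [q = n / 2] this yields
    the parity of [n]. *)
Lemma dist_distr_neq0_natr C (q : rat) : dist_distr C q != 0 ->
  exists d : nat, q = d%:R.
Proof.
rewrite mulf_eq0 negb_or pnatr_eq0 cards_eq0 => /andP[/set0Pn[p]].
by rewrite inE => /andP[_ /eqP <-]; exists (hamming p.1 p.2).
Qed.

Lemma distancesP C (q : rat) :
  reflect (exists x y, [/\ x \in C, y \in C & q = (hamming x y)%:R])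
          (q \in distances C).
Proof.
apply: (iffP mapP) => [[d]|[x [y [xC yC ->]]]].
  rewrite mem_filter /= => /andP[/dist_distr_eq0P h _ ->].
  have [/exists_inP[x xC /exists_inP[y yC /eqP<-]]|hN] :=
    boolP [exists x in C, exists y in C, hamming x y == d].
    by exists x, y.
  case: h => x y xC yC; apply: contra hN => hd.
  by apply/exists_inP; exists x => //; apply/exists_inP; exists y.
exists (hamming x y) => //; rewrite mem_filter mem_iota /= ltnS hamming_leq andbT.
by apply/dist_distr_eq0P => /(_ x y xC yC); rewrite eqxx.
Qed.

Lemma neigh0 C x : x \in C -> neigh C 0 x = [set x].
Proof.
move=> xC; apply/setP=> y; rewrite !inE hamming_eq0 andbC eq_sym.
by case: eqP => // ->.
Qed.

Lemma neighn C x : neigh C n x = C :&: [set compl x].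
Proof. by apply/setP=> y; rewrite !inE hamming_eqn. Qed.

Lemma dist_distr0 C : C != set0 -> dist_distr C 0 = 1.
Proof. by move=> C0; apply: (@dist_distr_const _ 0 1) => // x /neigh0->; rewrite cards1. Qed.

(** The only word at distance [n] from [x] is its complement, so [A_n(C)] averages numbers that are
    0 or 1; it equals 1 exactly when all of them do. *)
Lemma dist_distrn C : C != set0 ->
  self_complementary C <-> dist_distr C n%:R = 1.
Proof.
move=> C0; split=> [sC|/(dist_distr_sum C0) /eqP].
  apply: (@dist_distr_const _ _ 1) => // x xC.
  by rewrite neighn (setIidPr _) ?cards1 // sub1set sC.
rewrite mulr1 eqr_nat -sum1_card.
have hle x : x \in C -> (#|neigh C n x| <= 1 ?= iff (compl x \in C))%N.
  move=> _; have [] := subset_leqif_cards (subsetIr C [set compl x]).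
  rewrite cards1 -neighn => h1 h2; split=> //; rewrite h2 neighn.
  by apply/eqP/idP=> [/setIidPr|?]; [|apply/setIidPr]; rewrite sub1set.
by rewrite (leqif_sum hle).2 => /forall_inP.
Qed.

(* Here the distances from [x] are 0, [m] and [n], so the words at distance [m]
   are those of [C] minus [x] and its complement. *)
Lemma card_neigh_half C m x : (0 < m < n)%N ->
  self_complementary C ->
  (forall y, y \in C -> hamming x y \in [:: 0; m; n]%N) -> x \in C ->
  #|neigh C m x| = (#|C| - 2)%N.
Proof.
move=> hm sC hC xC.
have -> : neigh C m x = C :\: [set x; compl x].
  apply/setP=> y; rewrite !inE negb_or [RHS]andbC.
  have [yC /=|//] := boolP (y \in C).
  rewrite [y == x]eq_sym -hamming_eq0 -hamming_eqn.
  by have := hC _ yC; rewrite !inE; case/or3P=> /eqP->; lia.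
rewrite cardsD (setIidPr _) ?cards2; last by rewrite subUset !sub1set xC sC.
suff -> : x != compl x by [].
by rewrite -hamming_eqn (eqP (_ : hamming x x == 0%N)) ?hamming_eq0 //; lia.
Qed.

End Words.

(** * Sign matrices, their codes, and Gram matrices *)

Section Matrices.
Variable n : nat.
Implicit Types (H K : 'M[int]_n) (D : {set 'rV['F_2]_n}).

Definition sign_matrix H := forall i j, H i j = 1 \/ H i j = -1.

Definition word H i : 'rV['F_2]_n := \row_j (H i j != 1)%:R.

(** Negating a row complements its word, so the Boolean chooses between the rows of [H] and of [-H].
    The index set has [2n] elements, so a code of that size means that [sword] is injective. *)
Definition sword H (p : 'I_n * bool) :=
  if p.2 then compl (word H p.1) else word H p.1.

Definition code H := [set sword H p | p : 'I_n * bool].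

Lemma mem_code H p : sword H p \in code H.
Proof. exact: imset_f. Qed.

Lemma sgn_word H i j : sign_matrix H -> sgn (word H i 0 j) = H i j.
Proof. by move=> hH; rewrite mxE; case: (hH i j) => ->. Qed.

Lemma sword_gram H K p q : sign_matrix H -> sign_matrix K ->
  n%:Z - (2 * hamming (sword H p) (sword K q))%:Z
  = (-1) ^+ (p.2 (+) q.2) * (H *m K^T) p.1 q.1.
Proof.
move=> hH hK; rewrite -sgn_sum [(_ *m _) _ _]mxE big_distrr /=.
apply: eq_bigr => j _; rewrite [K^T _ _]mxE -!(sgn_word _ _ hH, sgn_word _ _ hK).
case: p q => i [] [k []] /=; rewrite ?(expr0, expr1) /sword /=.
- by rewrite 2![compl _ _ _]mxE [const_mx _ _ _]mxE !sgnD1 mulrNN mul1r.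
- by rewrite [compl _ _ _]mxE [const_mx _ _ _]mxE !sgnD1 !mulNr mul1r.
- by rewrite [compl _ _ _]mxE [const_mx _ _ _]mxE !sgnD1 mulrN mulN1r.
- by rewrite mul1r.
Qed.

Lemma sword_gram_abs H K p q : sign_matrix H -> sign_matrix K ->
  `|n%:Z - (2 * hamming (sword H p) (sword K q))%:Z|%N
  = `|(H *m K^T) p.1 q.1|%N.
Proof. by move=> hH hK; rewrite sword_gram // abszMsign. Qed.

Lemma code_self_complementary H : self_complementary (code H).
Proof.
move=> _ /imsetP[[i e] _ ->]; apply/imsetP; exists (i, ~~ e) => //.
by case: e; rewrite /sword //= -[X in X = _]/(compl (compl _)) complK.
Qed.

Lemma hadamard_gram H : hadamard H -> forall i j,
  (H *m H^T) i j = if i == j then n%:Z else 0.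
Proof. by move=> [_ ->] i j; rewrite !mxE natz; case: eqP => _; rewrite ?mulr1n ?mulr0n. Qed.

Lemma hadamard_code m H : (0 < m)%N -> n = (2 * m)%N -> hadamard H ->
  #|code H| = (2 * n)%N /\
  (forall x y, x \in code H -> y \in code H ->
     hamming x y \in [:: 0; m; n]%N).
Proof.
move=> m0 nE hH; have sH := hH.1; split; last first.
  move=> _ _ /imsetP[p _ ->] /imsetP[q _ ->].
  have := sword_gram_abs p q sH sH; rewrite hadamard_gram //.
  by rewrite !inE; case: eqP => _; lia.
rewrite card_imset; first by rewrite card_prod card_ord card_bool mulnC.
(* Equal words are at distance 0, so [n] is up to sign an entry of [H *m H^T]: being nonzero it is
   diagonal, and its sign forces [e = e']. *)
move=> [i e] [j e'] hij; have := sword_gram (i, e) (j, e') sH sH.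
rewrite hij (eqP (_ : hamming _ _ == 0)%N) ?hamming_eq0 // hadamard_gram //=.
by case: eqP => [->|_]; case: e e' {hij} => -[]; rewrite /= ?(expr0, expr1) //; lia.
Qed.

(** The size [2n] leaves no repetition among the words, so two different rows are neither equal nor
    opposite. This excludes the distances 0 and [n]; the remaining distance [m] means inner product
    0. *)
Lemma code_hadamard m H : (0 < m)%N -> n = (2 * m)%N -> sign_matrix H ->
  #|code H| = (2 * n)%N ->
  (forall x y, x \in code H -> y \in code H ->
     hamming x y \in [:: 0; m; n]%N) -> hadamard H.
Proof.
move=> m0 nE sH cH hH; split=> //; apply/matrixP=> i j.
have inj : injective (sword H).
  apply: in2T; apply/imset_injP; rewrite cardT -cardE.
  rewrite [X in _ == X](_ : _ = 2 * n)%N; last first.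
    by rewrite card_prod card_ord card_bool mulnC.
  by apply/eqP.
have := sword_gram (i, false) (j, false) sH sH; rewrite /= expr0 mul1r => <-.
have := hH _ _ (mem_code H (i, false)) (mem_code H (j, false)).
have := hamming_eq0 (sword H (i, false)) (sword H (j, false)).
have := hamming_eq0 (sword H (i, false)) (sword H (j, true)).
rewrite (_ : sword H (j, true) = compl (sword H (j, false))) //.
rewrite hamming_compl -[compl _]/(sword H (j, true)) !(inj_eq inj) !xpair_eqE.
rewrite andbF andbT mxE natz !inE.
by case: (i == j); rewrite ?mulr1n ?mulr0n; lia.
Qed.

(** Exactly one word of each complementary pair has first coordinate 0. These representatives form
    half of [D], that is [n] words, and their sign vectors serve as rows. *)
Lemma exists_code D : (0 < n)%N -> self_complementary D ->
  #|D| = (2 * n)%N -> exists2 H, sign_matrix H & code H = D.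
Proof.
move=> n0 sD cD; pose i0 := Ordinal n0.
pose R := [set x in D | x 0 i0 == 0].
have DE : D = R :|: [set compl x | x in R].
  apply/setP=> x; rewrite !inE; apply/idP/orP=> [xD|[/andP[]//|]]; last first.
    by move=> /imsetP[y]; rewrite inE => /andP[yD _] ->; apply: sD.
  case: (F2_case (x 0 i0)) => hx; first by left; rewrite xD hx.
  right; rewrite -[x]complK; apply: imset_f; rewrite inE sD //= !mxE hx.
  by apply/eqP/val_inj.
have cR : #|R| = n.
  have := cardsU R [set compl x | x in R]; rewrite -DE cD card_imset; last first.
    exact: can_inj (@complK _).
  rewrite (_ : R :&: _ = set0) ?cards0.
    by rewrite subn0 addnn -mul2n => /eqP; rewrite eqn_pmul2l // => /eqP.
  apply/setP=> x; rewrite !inE; apply/negP=> /andP[/andP[_ /eqP hx]].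
  by move=> /imsetP[y]; rewrite inE => /andP[_ /eqP hy] xE; move: hx; rewrite xE !mxE hy.
pose r i : 'rV['F_2]_n := enum_val (cast_ord (esym cR) i).
exists (\matrix_(i, j) sgn (r i 0 j)).
  by move=> i j; rewrite mxE; case: (F2_case (r i 0 j)) => ->; [left|right].
set H := \matrix_(i, j) _.
have wE i : word H i = r i.
  by apply/rowP=> j; rewrite !mxE; case: (F2_case (r i 0 j)) => ->.
have rR i : r i \in R by apply: enum_valP.
have rS x : x \in R -> exists i, r i = x.
  move=> xR; exists (cast_ord cR (enum_rank_in xR x)).
  by rewrite /r cast_ordK enum_rankK_in.
rewrite DE; apply/setP=> x; rewrite in_setU; apply/imsetP/orP.
  by case=> -[i []] _ ->; rewrite /sword wE /=; [right; apply: imset_f | left].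
case=> [/rS[i <-]|/imsetP[_ /rS[i <-] ->]]; first by exists (i, false); rewrite // /sword wE.
by exists (i, true); rewrite // /sword wE.
Qed.

(** Over the integers [H] need not be invertible, so it is cancelled from
    [H *m (H^T *m H) = H *m n%:R%:M] by multiplying with [\adj H] and then cancelling the nonzero
    [\det H]. *)
Lemma hadamard_trmx_mul H : (0 < n)%N -> hadamard H -> H^T *m H = n%:R%:M.
Proof.
move=> n0 [_ hH]; have dH : \det H != 0.
  apply/eqP=> d0; have := det_mulmx H H^T; rewrite hH d0 mul0r det_scalar.
  by move/eqP; rewrite expf_eq0 pnatr_eq0; lia.
have : \adj H *m (H *m (H^T *m H)) = \adj H *m (H *m n%:R%:M).
  by rewrite [H *m (_ *m _)]mulmxA hH -scalar_mxC.
rewrite [LHS]mulmxA [RHS]mulmxA mul_adj_mx => /matrixP hE.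
apply/matrixP=> i j; apply: (mulfI dH).
by have := hE i j; rewrite !mul_scalar_mx mxE [RHS]mxE.
Qed.

(* Parseval: up to the factor [n], the rows of [K] are an orthonormal basis. *)
Lemma hadamard_row_sum H K i : (0 < n)%N -> hadamard H -> hadamard K ->
  (\sum_j `|(H *m K^T) i j| ^ 2 = n ^ 2)%N.
Proof.
move=> n0 hH hK; apply/eqP; rewrite -eqz_nat -natz natr_sum; apply/eqP.
have : ((H *m K^T) *m (H *m K^T)^T) i i = (n ^ 2)%:Z.
  rewrite trmx_mul trmxK mulmxA -[H *m _ *m _]mulmxA hadamard_trmx_mul //.
  rewrite scalar_mxC -mulmxA hH.2 -scalar_mxM !mxE eqxx mulr1n; lia.
rewrite mxE => <-; apply: eq_bigr => j _; rewrite [_^T _ _]mxE; lia.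
Qed.

Lemma mem_sigma H K v :
  reflect (exists i j, v = `|(H *m K^T) i j|%N) (v \in sigma H K).
Proof.
rewrite mem_undup; apply: (iffP allpairsP) => [[[i j] [_ _ ->]]|[i [j ->]]].
  by exists i, j.
by exists (i, j); rewrite !mem_enum.
Qed.

(* The squares in each row sum to [n ^ 2], so whether a row takes both of
   its two allowed absolute values depends on [n] alone. *)
Lemma mem_sigma_hadamard H K (r s : nat) : (0 < n)%N -> (r < s)%N ->
  hadamard H -> hadamard K -> {subset sigma H K <= [:: r; s]} ->
  (r \in sigma H K) = (n < s ^ 2)%N /\ (s \in sigma H K) = (r ^ 2 < n)%N.
Proof.
move=> n0 rs hH hK hs; set M := H *m K^T.
have hM i j : `|M i j|%N = r \/ `|M i j|%N = s.
  have : `|M i j|%N \in sigma H K by apply/mem_sigma; exists i, j.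
  by move/hs; rewrite !inE => /orP[] /eqP; [left|right].
have sumE c : (\sum_(j < n) c ^ 2 = n * c ^ 2)%N.
  by rewrite sum_nat_const card_ord.
(* Comparing the row sum termwise with its upper bound gives [n ^ 2 <= n * s ^ 2], with equality iff
   every entry of the row has absolute value [s]; [lo] is the mirror image. *)
have up i : (n <= s ^ 2 ?= iff [forall j, `|M i j| == s])%N.
  have [] : (\sum_j `|M i j| ^ 2 <= \sum_(j < n) s ^ 2 ?= iff
             [forall j, `|M i j| == s])%N.
    apply: leqif_sum => j _; split; [case: (hM i j) => ->|];
      by rewrite ?leq_exp2r ?eqn_exp2r // ltnW.
  by rewrite hadamard_row_sum // sumE -mulnn leq_pmul2l // eqn_pmul2l.
have lo i : (r ^ 2 <= n ?= iff [forall j, r == `|M i j|])%N.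
  have [] : (\sum_(j < n) r ^ 2 <= \sum_j `|M i j| ^ 2 ?= iff
             [forall j, r == `|M i j|])%N.
    apply: leqif_sum => j _; split; [case: (hM i j) => ->|];
      by rewrite ?leq_exp2r ?eqn_exp2r // ltnW.
  by rewrite hadamard_row_sum // sumE -mulnn leq_pmul2l // eqn_pmul2l.
(* The bounds hold in every row, so a strict inequality yields a witness in any row; the first is
   taken. *)
pose i0 := Ordinal n0; split; apply/mem_sigma/idP.
- move=> [i [j rE]]; rewrite ltn_neqAle (up i).1 andbT.
  by rewrite (up i).2; apply/forallPn; exists j; rewrite -rE neq_ltn rs.
- rewrite ltn_neqAle (up i0).1 andbT (up i0).2 => /forallPn[j hj].
  by exists i0, j; case: (hM i0 j) hj => -> //; rewrite eqxx.
- move=> [i [j rE]]; rewrite ltn_neqAle (lo i).1 andbT.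
  by rewrite (lo i).2; apply/forallPn; exists j; rewrite -rE neq_ltn rs.
rewrite ltn_neqAle (lo i0).1 andbT (lo i0).2 => /forallPn[j hj].
by exists i0, j; case: (hM i0 j) hj => -> //; rewrite eqxx.
Qed.

End Matrices.

(** * Disjointness and the union bound *)

Lemma disjoint_card_bigcup (T I : finType) (F : I -> {set T}) :
  (forall i j, i != j -> [disjoint F i & F j]) ->
  #|\bigcup_i F i| = (\sum_i #|F i|)%N.
Proof.
move=> dF; rewrite -sum1_card partition_disjoint_bigcup //.
by apply: eq_bigr => i _; rewrite sum1_card.
Qed.

(** Equality in the union bound leaves no room for overlap: the other sets have a union no larger
    than the sum of their sizes, so inclusion-exclusion makes its intersection with [F i] empty. *)
Lemma card_bigcup_disjoint (T I : finType) (F : I -> {set T}) i j :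
  #|\bigcup_i F i| = (\sum_i #|F i|)%N -> i != j -> [disjoint F i & F j].
Proof.
move=> cF ij; rewrite -setI_eq0 -subset0.
apply: (subset_trans (setIS _ (bigcup_sup (P := predC1 i) j _))); first by rewrite /= eq_sym.
rewrite subset0 -cards_eq0; move: cF; rewrite (bigD1 i) //= (bigD1 i (F := fun i => #|F i|)) //=.
have le1 : (#|\bigcup_(k | k != i) F k| <= \sum_(k | k != i) #|F k|)%N.
  elim/big_rec2: _ => [|k c A _ leA]; first by rewrite cards0.
  by rewrite (leq_trans (leq_card_setU _ _)) ?leq_add2l.
have := cardsUI (F i) (\bigcup_(k | k != i) F k); lia.
Qed.

(** * The two constructions, for even length [n = 2m] *)

Section Families.
Variables (n m f a b : nat).
Hypotheses (nE : n = (2 * m)%N) (a0 : (0 < a)%N) (ab : (a < b)%N) (bm : (b < m)%N).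

(** Halving [n - 2h = +-2c] gives [h = m -+ c]; the subtractions do not truncate, since
    [a < b < m]. *)
Lemma cross_distance (h : nat) : `|n%:Z - (2 * h)%:Z|%N \in [:: (2 * a)%N; (2 * b)%N] ->
  h \in [:: m - a; m + a; m - b; m + b]%N.
Proof. by rewrite !inE; lia. Qed.

(** The blocks are the codes of the members of [S]. As [0 < a < b < m], words of different blocks
    are never at distance 0 or [m], which gives disjointness and the count at distance [m]. *)
Lemma code_of_family (S : seq 'M[int]_n) :
  uniq S -> size S = f -> (1 < f)%N -> {in S, forall H, hadamard H} ->
  {in S &, forall H K, H != K -> sigma H K =i [:: (2 * a)%N; (2 * b)%N]} ->
  exists (C : {set 'rV['F_2]_n}) (D : 'I_f -> {set 'rV['F_2]_n}),
    [/\ C = \bigcup_k D k /\ #|C| = (2 * f * n)%N, self_complementary C,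
        distances C =i [seq i%:R | i <- [:: 0; m - a; m + a; m - b; m + b; m; n]%N],
        dist_distr C m%:R = (2 * n - 2)%:R
      & forall k, [/\ D k != set0, self_complementary (D k),
          dist_distr (D k) m%:R = (2 * n - 2)%:R
        & forall x y, x \in D k -> y \in D k -> hamming x y \in [:: 0; m; n]%N]].
Proof.
move=> uS sS f1 hS sigS; pose H (k : 'I_f) := nth 0 S k.
have HS k : H k \in S by rewrite mem_nth ?sS.
have hH k : hadamard (H k) by apply: hS.
have sH k := (hH k).1.
have Hinj k l : k != l -> H k != H l by rewrite nth_uniq ?sS.
pose D k := code (H k).
have m0 : (0 < m)%N by lia.
have cD k : #|D k| = (2 * n)%N := (hadamard_code m0 nE (hH k)).1.
have dD k := (hadamard_code m0 nE (hH k)).2.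
have scD k : self_complementary (D k) := @code_self_complementary _ _.
have D0 k : D k != set0 by rewrite -card_gt0 cD; lia.
have cross k l x y : k != l -> x \in D k -> y \in D l ->
    hamming x y \in [:: m - a; m + a; m - b; m + b]%N.
  move=> kl /imsetP[p _ ->] /imsetP[q _ ->]; apply: cross_distance.
  rewrite sword_gram_abs // -(sigS _ _ (HS k) (HS l) (Hinj _ _ kl)).
  by apply/mem_sigma; exists p.1, q.1.
have dis k l : k != l -> [disjoint D k & D l].
  move=> kl; apply/pred0Pn=> -[x /andP[/= xk xl]].
  have := cross _ _ _ _ kl xk xl.
  by rewrite (eqP (_ : hamming x x == 0)%N) ?hamming_eq0 // !inE; lia.
pose C := \bigcup_k D k.
have cC : #|C| = (2 * f * n)%N.
  rewrite disjoint_card_bigcup // (eq_bigr _ (fun k _ => cD k)) sum_nat_const card_ord.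
  by rewrite mulnA [(f * 2)%N]mulnC.
have scC : self_complementary C.
  by move=> x /bigcupP[k _ xk]; apply/bigcupP; exists k => //; apply: scD.
have neighD k x : x \in D k -> #|neigh (D k) m x| = (2 * n - 2)%N.
  by move=> xk; rewrite card_neigh_half ?cD // => [|y]; [lia|apply: dD].
have neighC x : x \in C -> #|neigh C m x| = (2 * n - 2)%N.
  move=> /bigcupP[k _ xk]; rewrite -(neighD k x xk); apply: eq_card => y.
  rewrite !inE; case: eqP => [hm|]; rewrite ?andbF // !andbT.
  apply/bigcupP/idP => [[l _ yl]|yk]; last by exists k.
  have [->//|kl] := eqVneq k l; have := cross _ _ _ _ kl xk yl.
  by rewrite hm !inE; lia.
have C0 : C != set0 by rewrite -card_gt0 cC !muln_gt0 !(ltnW f1); lia.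
exists C, D; split=> //.
- move=> q; apply/distancesP/mapP => [[x [y [/bigcupP[k _ xk] /bigcupP[l _ yl] ->]]]|].
    exists (hamming x y) => //; have [kl|kl] := eqVneq k l.
      rewrite -kl in yl; have := dD k _ _ xk yl; rewrite !inE; lia.
    have := cross _ _ _ _ kl xk yl; rewrite !inE; lia.
  (* Two distinct members exist since [1 < f], and [2c] occurs in their Gram matrix. The resulting
     pair of words realizes one of [m - c] and [m + c]; complementing its second word realizes the
     other. *)
  have sigC c : c \in [:: a; b] -> forall h, h \in [:: m - c; m + c]%N ->
      exists x y, [/\ x \in C, y \in C & h%:R = (hamming x y)%:R :> rat].
    move=> cab h hc; pose k0 := Ordinal (ltnW f1); pose k1 := Ordinal f1.
    have : (2 * c)%N \in sigma (H k0) (H k1).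
      rewrite (sigS _ _ (HS k0) (HS k1)) ?Hinj //.
      by move: cab; rewrite !inE !eqn_pmul2l.
    move=> /mem_sigma[i [j]].
    have -> := esym (sword_gram_abs (i, false) (j, false) (sH k0) (sH k1)).
    set x := sword _ _; set y := sword _ _ => hxy.
    have xC : x \in C by apply/bigcupP; exists k0; rewrite ?mem_code.
    have yC : y \in C by apply/bigcupP; exists k1; rewrite ?mem_code.
    have [->|hN] := eqVneq h (hamming x y); first by exists x, y.
    exists x, (compl y); split => //; first exact: scC.
    congr _%:R; rewrite hamming_compl.
    by move: hc cab hN; rewrite !inE; lia.
  have [x xC] := set0Pn _ C0.
  move=> [d]; rewrite !inE => /or4P[|||/or4P[|||]] /eqP-> ->.
  - by exists x, x; rewrite (eqP (_ : hamming x x == 0)%N) ?hamming_eq0.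
  - by apply: (sigC a); rewrite !inE eqxx ?orbT.
  - by apply: (sigC a); rewrite !inE eqxx ?orbT.
  - by apply: (sigC b); rewrite !inE eqxx ?orbT.
  - by apply: (sigC b); rewrite !inE eqxx ?orbT.
  - have : (0 < #|neigh C m x|)%N by rewrite neighC //; lia.
    rewrite card_gt0 => /set0Pn[y]; rewrite inE => /andP[yC /eqP hy].
    by exists x, y; rewrite hy.
  - exists x, (compl x); rewrite (eqP (_ : hamming x _ == n)%N) ?hamming_eqn //.
    by split=> //; apply: scC.
- exact: dist_distr_const neighC.
move=> k; split=> //; [exact: dist_distr_const (neighD k)|exact: dD].
Qed.

Lemma family_of_code (C : {set 'rV['F_2]_n}) (D : 'I_f -> {set 'rV['F_2]_n}) :
  ~~ odd a -> ~~ odd b ->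
  C = \bigcup_k D k -> #|C| = (2 * f * n)%N -> C != set0 ->
  distances C =i [seq i%:R | i <- [:: 0; m - a; m + a; m - b; m + b; m; n]%N] ->
  dist_distr C m%:R = (2 * n - 2)%:R ->
  (forall k, [/\ D k != set0, self_complementary (D k),
          dist_distr (D k) m%:R = (2 * n - 2)%:R
        & forall x y, x \in D k -> y \in D k -> hamming x y \in [:: 0; m; n]%N]) ->
  exists S : seq 'M[int]_n,
    [/\ uniq S, size S = f,
        forall H, H \in S -> hadamard H,
        mutually_typeII_weakly_unbiased S
      & {in S &, forall H K, H != K ->
          sigma H K =i [:: (2 * a)%N; (2 * b)%N]}].
Proof.
move=> ea eb CE cC C0 dC distC hD.
have m0 : (0 < m)%N by lia.
have dD k : forall x y, x \in D k -> y \in D k -> hamming x y \in [:: 0; m; n]%N.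
  by case: (hD k).
have scD k : self_complementary (D k) by case: (hD k).
have D0 k : D k != set0 by case: (hD k).
have neighD k x : x \in D k -> #|neigh (D k) m x| = (#|D k| - 2)%N.
  by move=> xk; apply: card_neigh_half => // [|y]; [lia|apply: dD].
(* Every word of [D k] has [#|D k| - 2] neighbours at distance [m]; since [2n - 2] is positive,
   truncation hides nothing. *)
have cD k : #|D k| = (2 * n)%N.
  have [_ _ + _] := hD k; rewrite (dist_distr_const (D0 k) (@neighD k)).
  by move/eqP; rewrite eqr_nat; lia.
(* The sizes [2n] add up to [#|C|], so the union bound is attained. *)
have dis k l : k != l -> [disjoint D k & D l].
  apply: card_bigcup_disjoint; rewrite -CE cC (eq_bigr _ (fun k _ => cD k)).
  by rewrite sum_nat_const card_ord mulnA [(f * 2)%N]mulnC.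
have memD k l x : x \in D k -> x \in D l -> k = l.
  move=> xk xl; apply/eqP/negPn/negP=> /dis/pred0P/(_ x).
  by rewrite /= xk xl.
have DC k x : x \in D k -> x \in C by move=> xk; rewrite CE; apply/bigcupP; exists k.
(* Each code word already has [2n - 2] neighbours at distance [m] in its own
   block, and this is the average over [C]. *)
have neighC k x : x \in D k -> neigh (D k) m x = neigh C m x.
  have sub l z : z \in D l -> neigh (D l) m z \subset neigh C m z.
    by move=> zl; apply/subsetP=> y; rewrite !inE => /andP[/DC-> ->].
  have le z : z \in C -> (2 * n - 2 <= #|neigh C m z|
                          ?= iff (2 * n - 2 == #|neigh C m z|))%N.
    rewrite CE => /bigcupP[l _ zl]; apply: leqif_eq.
    by rewrite -CE -(cD l) -(neighD l z zl) subset_leq_card // sub.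
  move=> xk; apply/eqP; rewrite eqEcard sub //= (neighD k x xk) cD.
  have := (leqif_sum le).2; have /eqP := dist_distr_sum C0 distC.
  rewrite -natrM eqr_nat => /eqP->; rewrite sum_nat_const eqxx.
  by move/esym/forall_inP/(_ x (DC _ _ xk)) => /eqP <-.
have cross k l x y : k != l -> x \in D k -> y \in D l ->
    hamming x y \in [:: m - a; m + a; m - b; m + b]%N.
  move=> kl xk yl; have : (hamming x y)%:R \in distances C.
    by apply/distancesP; exists x, y; split=> //; [apply: DC xk|apply: DC yl].
  (* At distance 0, [n] or [m], the word [y] would be [x], its complement, or a neighbour at
     distance [m]; all of these lie in [D k]. *)
  have yNk : y \notin D k by apply: contraNN kl => yk; apply/eqP/(memD _ _ y).
  rewrite dC mem_map; last by move=> ? ? /eqP; rewrite eqr_nat => /eqP.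
  have h0 : hamming x y != 0%N.
    by rewrite hamming_eq0; apply: contraNneq yNk => <-.
  have hn : hamming x y != n.
    by rewrite hamming_eqn; apply: contraNneq yNk => ->; apply: scD.
  have hm : hamming x y != m.
    apply: contraNneq yNk => hm; suff : y \in neigh (D k) m x by rewrite inE => /andP[].
    by rewrite (neighC _ _ xk) inE hm eqxx (DC _ _ yl).
  by move: h0 hn hm; rewrite !inE; lia.
have [H HP] : exists H : 'I_f -> 'M[int]_n,
    forall k, sign_matrix (H k) /\ code (H k) = D k.
  apply: (fin_all_exists (P := fun k A => sign_matrix A /\ code A = D k)) => k.
  have n0 : (0 < n)%N by lia.
  by have [A] := exists_code n0 (scD k) (cD k); exists A.
have sH k : sign_matrix (H k) by case: (HP k).
have codeH k : code (H k) = D k by case: (HP k).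
have hH k : hadamard (H k).
  by apply: (code_hadamard m0 nE (sH k)); rewrite codeH ?cD //; apply: dD.
(* Equal matrices have equal codes, whereas distinct blocks are nonempty and disjoint. *)
have Hinj : injective H.
  move=> k l hkl; have /set0Pn[x xk] := D0 k.
  by apply: (memD _ _ x xk); rewrite -codeH -hkl codeH.
have swordD k p : sword (H k) p \in D k by rewrite -codeH mem_code.
have sub k l : k != l -> {subset sigma (H k) (H l) <= [:: (2 * a)%N; (2 * b)%N]}.
  move=> kl v /mem_sigma[i [j ->]].
  have -> := esym (sword_gram_abs (i, false) (j, false) (sH k) (sH l)).
  have := cross _ _ _ _ kl (swordD k (i, false)) (swordD l (j, false)).
  by rewrite !inE; lia.
have n0 : (0 < n)%N by lia.
have rs : (2 * a < 2 * b)%N by lia.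
have mem k l := fun kl => mem_sigma_hadamard n0 rs (hH k) (hH l) (sub k l kl).
(* The distance [m + c] occurs in [C] but in no single block, so it comes from two distinct
   blocks. *)
have ex c : c \in [:: a; b] -> exists k l, k != l /\ (2 * c)%N \in sigma (H k) (H l).
  move=> cab; have : (m + c)%:R \in distances C.
    rewrite dC; apply: map_f; move: cab; rewrite !inE; lia.
  move=> /distancesP[x [y [+ + /eqP]]]; rewrite eqr_nat => + + /eqP hxy.
  rewrite {1 2}CE => /bigcupP[k _ xk] /bigcupP[l _ yl]; exists k, l; split.
    apply/eqP=> kl; rewrite -kl in yl; have := dD _ _ _ xk yl.
    by rewrite -hxy; move: cab; rewrite !inE; lia.
  move: xk yl; rewrite -!codeH => /imsetP[p _ xE] /imsetP[q _ yE].
  apply/mem_sigma; exists p.1, q.1; rewrite -sword_gram_abs // -xE -yE -hxy.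
  by lia.
have sig k l : k != l -> sigma (H k) (H l) =i [:: (2 * a)%N; (2 * b)%N].
  move=> kl v; apply/idP/idP; first exact: sub.
  (* The values [2a] and [2b] may come from different pairs of blocks. They give [n < (2b)^2] and
     [(2a)^2 < n], and these inequalities return both values for the pair [k], [l]. *)
  have [[k1 [l1 [kl1 h1]]] [k2 [l2 [kl2 h2]]]] := (ex a (mem_head _ _), ex b (mem_last a [:: b])).
  move: h1 h2; rewrite (mem _ _ kl1).1 (mem _ _ kl2).2 => h1 h2.
  by rewrite !inE => /orP[] /eqP ->; rewrite ((mem _ _ kl).1, (mem _ _ kl).2).
have sigS : {in [seq H k | k : 'I_f] &, forall A B, A != B ->
    sigma A B =i [:: (2 * a)%N; (2 * b)%N]}.
  by move=> _ _ /imageP[k _ ->] /imageP[l _ ->]; rewrite (inj_eq Hinj); apply: sig.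
exists [seq H k | k : 'I_f]; split=> //.
- by rewrite map_inj_uniq ?enum_uniq.
- by rewrite size_map -cardE card_ord.
- by move=> _ /imageP[k _ ->].
move=> A B AS BS AB; have sAB := sigS _ _ AS BS AB; split.
(* As [a] and [b] are even, 4 divides [2a] and [2b]. *)
- move=> i j; apply/eqP; rewrite eqz_mod_dvd subr0 dvdzE.
  have : `|(A *m B^T) i j|%N \in sigma A B by apply/mem_sigma; exists i, j.
  rewrite sAB !inE -[`|4|%N]/(2 * 2)%N.
  by case/orP=> /eqP ->; rewrite dvdn_pmul2l // dvdn2.
- rewrite (uniq_leq_size (s2 := [:: (2 * a)%N; (2 * b)%N])) ?undup_uniq //.
  by move=> v; rewrite sAB.
(* An unbiased pair has a single absolute value, but both [2a] and [2b] occur. *)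
have /mem_sigma[i [j hij]] : (2 * a)%N \in sigma A B by rewrite sAB mem_head.
have /mem_sigma[k [l hkl]] : (2 * b)%N \in sigma A B by rewrite sAB !inE eqxx orbT.
move=> ub; have /eqP := ub i j; rewrite -(ub k l) -hij -hkl eqr_nat; lia.
Qed.

End Families.

(** * The equivalence, with rational indices [n / 2] translated to natural distances *)

Theorem theorem8p4 (n f a b : nat) (hn : (0 < n)%N) (hf : (1 < f)%N)
    (ha : ~~ odd a) (hb : ~~ odd b) (ha0 : (0 < a)%N) (hab : (a < b)%N)
    (hbn : b%:R < n%:R / 2 :> rat) :
  (exists C : {set 'rV['F_2]_n},
    [/\ #|C| = (2 * f * n)%N,
        self_complementary C,
        distances C =i
          [:: 0; n%:R / 2 - a%:R; n%:R / 2 + a%:R;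
                 n%:R / 2 - b%:R; n%:R / 2 + b%:R; n%:R / 2; n%:R],
        dist_distr C (n%:R / 2) = 2 * n%:R - 2
      & exists D : 'I_f -> {set 'rV['F_2]_n},
          C = \bigcup_(k < f) D k /\
          forall k : 'I_f,
            [/\ dist_distr (D k) 0 = 1,
                dist_distr (D k) (n%:R / 2) = 2 * n%:R - 2,
                dist_distr (D k) n%:R = 1
              & forall j : nat, (j <= n)%N ->
                  (j%:R : rat) \notin [:: 0; n%:R / 2; n%:R] ->
                  dist_distr (D k) j%:R = 0]])
  <->
  (exists S : seq 'M[int]_n,
    [/\ uniq S, size S = f,
        forall H, H \in S -> hadamard H,
        mutually_typeII_weakly_unbiased S
      & {in S &, forall H K, H != K ->
          sigma H K =i [:: (2 * a)%N; (2 * b)%N]}]).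
Proof.
split.
- move=> [C [cC scC dC distC [D [CE hD]]]].
  have C0 : C != set0.
    by rewrite -card_gt0 cC !muln_gt0 hn (ltnW hf).
  have n4 : (2 * b < n)%N.
    by rewrite -(ltr_nat rat) natrM; move: hbn; lra.
  (* [A_{n/2}(C) = 2n - 2] is nonzero, so some pair is at distance [n / 2] and [n] is even. *)
  have [m mE] : exists m : nat, n%:R / 2 = m%:R :> rat.
    apply: (@dist_distr_neq0_natr _ C); rewrite distC.
    by rewrite -natrM -natrB ?pnatr_eq0; lia.
  have nE : n = (2 * m)%N.
    by apply/eqP; rewrite -(eqr_nat rat) natrM -mE; lra.
  have cE : 2 * n%:R - 2 = (2 * n - 2)%:R :> rat by rewrite natrB ?natrM //; lia.
  apply: (@family_of_code n m f a b nE ha0 hab _ C D) => //; first lia.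
  + move=> q; rewrite dC mE -!natrB -?natrD //; lia.
  + by rewrite -mE distC cE.
  move=> k; have [h0 hm hN hj] := hD k.
  (* An empty block would have [A_0 = 0 / 0 = 0] instead of 1. *)
  have D0 : D k != set0.
    apply: contra_eq_neq h0 => ->.
    by rewrite /dist_distr cards0 invr0 mulr0 eq_sym oner_eq0.
  split=> //; first exact/dist_distrn.
    by rewrite -mE hm cE.
  move=> x y xk yk; apply: contraT => hxy.
  have : dist_distr (D k) (hamming x y)%:R == 0.
    rewrite hj ?hamming_leq // mE.
    by move: hxy; rewrite !inE !(eqr_nat rat _ _) (pnatr_eq0 rat).
  by move/dist_distr_eq0P/(_ x y xk yk); rewrite eqxx.
move=> [S [uS sS hS tS sigS]].
have n4 : (2 * b < n)%N.
  by rewrite -(ltr_nat rat) natrM; move: hbn; lra.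
(* Since [1 < f] there are two distinct members, and an inner product [n - 2h] of absolute value
   [2a] makes [n] even. *)
have [m nE] : exists m, n = (2 * m)%N.
  have [H [K [HS KS HK]]] : exists H K, [/\ H \in S, K \in S & H != K].
    by exists (nth 0 S 0), (nth 0 S 1); rewrite !mem_nth ?nth_uniq ?sS // ltnW.
  have /mem_sigma[i [j]] : (2 * a)%N \in sigma H K by rewrite sigS ?mem_head.
  have -> := esym (sword_gram_abs (i, false) (j, false) (hS _ HS).1 (hS _ KS).1).
  by move=> e; exists n./2; lia.
have mE : n%:R / 2 = m%:R :> rat by rewrite nE natrM; lra.
have cE : 2 * n%:R - 2 = (2 * n - 2)%:R :> rat by rewrite natrB ?natrM //; lia.
have bm : (b < m)%N by lia.
have [C [D [[CE cC] scC dC distC hD]]] := code_of_family nE ha0 hab bm uS sS hf hS sigS.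
exists C; split=> //.
- move=> q; rewrite dC mE -!natrB -?natrD //; lia.
- by rewrite mE cE.
exists D; split=> // k; have [D0 scD distD dD] := hD k; split.
- exact: dist_distr0.
- by rewrite mE cE.
- exact/dist_distrn.
move=> j jn; rewrite mE => jN; apply/eqP/dist_distr_eq0P => x y xk yk.
apply: contraNneq jN => <-; have := dD x y xk yk.
by rewrite !inE => /or3P[] /eqP->; rewrite eqxx ?orbT.
Qed.
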